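(* Let $a_0,a_1,a_2,a_3$ be nonnegative integers satisfying $a_i+a_{i+2}\ge a_{i+1}$ for $i=-1,0,1,2$ with the convention $a_{-1}=a_4=0$, i.e. \[ a_1\ge a_0,\quad a_0+a_2\ge a_1,\quad a_1+a_3\ge a_2,\quad a_2\ge a_3. \] For a random chain complex $0\leftarrow A_0\xleftarrow{d_1}A_1\xleftarrow{d_2}A_2\xleftarrow{d_3}A_3\leftarrow 0$ with $A_i=\mathbb R^{a_i}$, almost surely \[ \beta_0+\beta_1+\beta_2+\beta_3=|\chi|,\qquad \chi=a_0-a_1+a_2-a_3. \]
   Context: Model of a random chain complex: fix nonnegative integers $\vec a=(a_0,\dots,a_n)$ and $A_i=\mathbb R^{a_i}$. A sequence of linear maps $d_i:A_i\to A_{i-1}$ ($i=1,\dots,n$) is a point of $\mathbb R^N$, $N=\sum_{i=1}^n a_{i-1}a_i$. Let $M(\vec a)\subseteq\mathbb R^N$ be the real affine algebraic variety of chain complexes ($d_i\circ d_{i+1}=0$ for all $i$); let $k$ be its Hausdorff dimension. Fix a bounded measurable probability density $f$ on $\mathbb R^N$ (e.g.\ standard Gaussian) with $\int_{M(\vec a)} f\,d\mathcal H^k>0$. For a subvariety $Y\subseteq M(\vec a)$ define $\Pr(Y)=\int_Y f\,d\mathcal H^k/\int_{M(\vec a)} f\,d\mathcal H^k$, $\mathcal H^k$ the $k$-dimensional Hausdorff measure. A random chain complex is a point of $M(\vec a)$ under this measure; ''almost surely'' means with probability $1$. Betti numbers: with $r_i=\operatorname{rank} d_i$ and $r_0=r_{n+1}=0$,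 $\beta_i=a_i-r_i-r_{i+1}$. Here $n=3$. *)

(* Defs.v *)
From HB Require Import structures.
From mathcomp Require Import all_boot all_order all_algebra.
From mathcomp Require Import all_classical all_reals all_analysis.
Unset Printing Implicit Defensive.
Import Order.TTheory GRing.Theory Num.Theory.
Import numFieldNormedType.Exports.
Local Open Scope classical_set_scope.
Local Open Scope ring_scope.

Section RandomChainComplex.
Context {R : realType}.

(** * The ambient space R^N, as N-tuples of reals (Borel product sigma-algebra). *)

Definition edist {N : nat} (x y : N.-tuple R) : R :=
  Num.sqrt (\sum_(i < N) (tnth x i - tnth y i) ^+ 2).

(** Diameter of a set (in \bar R); the diameter of the empty set is 0. *)
Definition ediam {N : nat} (C : set (N.-tuple R)) : \bar R :=
  maxe 0%E (ereal_sup [set (edist x y)%:E | x in C & y in C]).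

Definition hcontrib {N : nat} (s : R) (C : set (N.-tuple R)) : \bar R :=
  if `[< C !=set0 >] then ((fine (ediam C)) `^ s)%:E else 0%E.

Definition hausdorff_delta {N : nat} (s delta : R) (A : set (N.-tuple R))
  : \bar R :=
  ereal_inf [set (\sum_(i <oo) hcontrib s (C i))%E |
              C in [set C : nat -> set (N.-tuple R) |
                    A `<=` \bigcup_i C i /\
                    forall i, (ediam (C i) <= delta%:E)%E]].

(** s-dimensional Hausdorff (outer) measure H^s (unnormalized, i.e. without
    the constant factor omega_s / 2^s). *)
Definition hausdorff {N : nat} (s : R) (A : set (N.-tuple R)) : \bar R :=
  ereal_sup [set hausdorff_delta s delta A | delta in [set d : R | 0 < d]].

Definition hausdorff_dim {N : nat} (A : set (N.-tuple R)) : \bar R :=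
  ereal_inf [set s%:E | s in [set s : R | 0 <= s /\ hausdorff s A = 0%E]].

Definition box {N : nat} (a b : N.-tuple R) : set (N.-tuple R) :=
  [set x | forall i, tnth a i <= tnth x i <= tnth b i].
Definition box_vol {N : nat} (a b : N.-tuple R) : R :=
  \prod_(i < N) (tnth b i - tnth a i).
Definition lebesgueN (N : nat) (A : set (N.-tuple R)) : \bar R :=
  ereal_inf [set (\sum_(k <oo) (box_vol (ab k).1 (ab k).2)%:E)%E |
              ab in [set ab : nat -> N.-tuple R * N.-tuple R |
                     (forall k i, tnth (ab k).1 i <= tnth (ab k).2 i) /\
                     A `<=` \bigcup_k box (ab k).1 (ab k).2]].

Definition dimN (a0 a1 a2 a3 : nat) : nat := a0 * a1 + a1 * a2 + a2 * a3.

(** Coordinates of x in R^N arranged into the three matrices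
    d1 : R^{a1} -> R^{a0}, d2 : R^{a2} -> R^{a1}, d3 : R^{a3} -> R^{a2}
    (acting on column vectors). *)
Definition mat_d1 {a0 a1 a2 a3 : nat} (x : (dimN a0 a1 a2 a3).-tuple R)
  : 'M[R]_(a0, a1) :=
  \matrix_(i < a0, j < a1) nth 0 x (i * a1 + j).
Definition mat_d2 {a0 a1 a2 a3 : nat} (x : (dimN a0 a1 a2 a3).-tuple R)
  : 'M[R]_(a1, a2) :=
  \matrix_(i < a1, j < a2) nth 0 x (a0 * a1 + i * a2 + j).
Definition mat_d3 {a0 a1 a2 a3 : nat} (x : (dimN a0 a1 a2 a3).-tuple R)
  : 'M[R]_(a2, a3) :=
  \matrix_(i < a2, j < a3) nth 0 x (a0 * a1 + a1 * a2 + i * a3 + j).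

Definition chain_complexes (a0 a1 a2 a3 : nat)
  : set ((dimN a0 a1 a2 a3).-tuple R) :=
  [set x | mat_d1 x *m mat_d2 x = 0 /\ mat_d2 x *m mat_d3 x = 0].

(** Betti numbers beta_i = a_i - r_i - r_{i+1}, r_0 = r_4 = 0 (as integers). *)
Definition betti_sum {a0 a1 a2 a3 : nat} (x : (dimN a0 a1 a2 a3).-tuple R)
  : int :=
  let r1 := (\rank (mat_d1 x))%:Z in
  let r2 := (\rank (mat_d2 x))%:Z in
  let r3 := (\rank (mat_d3 x))%:Z in
  (a0%:Z - r1) + (a1%:Z - r1 - r2) + (a2%:Z - r2 - r3) + (a3%:Z - r3).

Definition euler_char (a0 a1 a2 a3 : nat) : int :=
  a0%:Z - a1%:Z + a2%:Z - a3%:Z.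

(** k = Hausdorff dimension of M(a) (a real number, M(a) being nonempty). *)
Definition model_dim (a0 a1 a2 a3 : nat) : R :=
  fine (hausdorff_dim (chain_complexes a0 a1 a2 a3)).

Definition cx_mass {a0 a1 a2 a3 : nat} (f : (dimN a0 a1 a2 a3).-tuple R -> R)
  (Y : set ((dimN a0 a1 a2 a3).-tuple R)) : \bar R :=
  (\int[hausdorff (model_dim a0 a1 a2 a3)]_(x in Y) (f x)%:E)%E.

Definition cx_prob {a0 a1 a2 a3 : nat} (f : (dimN a0 a1 a2 a3).-tuple R -> R)
  (Y : set ((dimN a0 a1 a2 a3).-tuple R)) : \bar R :=
  (cx_mass f Y / cx_mass f (chain_complexes a0 a1 a2 a3))%E.

Definition bounded_density {N : nat} (f : N.-tuple R -> R) : Prop :=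
  [/\ measurable_fun setT f,
      (forall x, 0 <= f x),
      (exists C : R, forall x, f x <= C) &
      (\int[@lebesgueN N]_(x in setT) (f x)%:E = 1)%E].

End RandomChainComplex.

(* Main.v *)
(** The complexes with ranks r = (r1, r2, r3) are covered by finitely many
    images, under polynomial maps, of R^D(r), where
    D(r) = sum_i r_i (beta_(i-1) + r_i + r_(i+1) + beta_i); so this stratum is
    H^s-null for s > D(r). Conversely, D(r) suitable matrix entries,
    prescribed near those of identity pivot blocks, can always be completed to
    a complex, so some coordinate projection of the variety contains a cube of
    R^D(r) and the Hausdorff dimension k is at least D(r), for every feasible r.
    If the Betti numbers do not sum to |chi|, some even and some odd one are
    positive, and there are feasible ranks r' with D(r') > D(r): hence
    k > D(r), and the stratum of r is H^k-null. *)
Require Import Defs.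
From HB Require Import structures.
From mathcomp Require Import all_boot all_order all_algebra perm fingroup.
From mathcomp Require Import all_classical all_reals all_analysis.
From mathcomp Require Import measurable_realfun.
From mathcomp Require Import zify ring lra.
Import Order.TTheory GRing.Theory Num.Theory.
Import numFieldNormedType.Exports.
Local Open Scope classical_set_scope.
Local Open Scope ring_scope.

(** * The Hausdorff outer measure *)

(** D(r) counts parameters one differential at a time: once d_(i-1) is fixed, d_i is a matrix of
    rank r_i from A_i into ker d_(i-1), a space of dimension r_i + beta_(i-1), and p x q matrices of
    rank r depend on r (p + q - r) parameters. A chart of D parameters is null only for exponents
    above D, which is why the comparison of strata has to be strict. The cube behind the lower bound
    is measured by integrating indicators of boxes over one coordinate at a time, so that only
    Lebesgue measure on the line enters. The last obstacle is that H^k is handled as an outer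
    measure: the integral against it is a supremum over simple functions, with no additivity at
    hand. Going from a null complement to probability 1 therefore means cutting simple functions
    down to the good set, which has to be Borel; hence the description of ranks by minors. *)

Section HausdorffOuterMeasure.
Context {R : realType} {N : nat}.
Implicit Types (A B C : set (N.-tuple R)) (s d : R).
Local Open Scope ereal_scope.

Lemma hcontrib_ge0 s C : 0 <= hcontrib s C.
Proof. by rewrite /hcontrib; case: ifP => // _; rewrite lee_fin powR_ge0. Qed.

Lemma hcontrib0 s : hcontrib s (@set0 (N.-tuple R)) = 0.
Proof. by rewrite /hcontrib asboolF// => -[]. Qed.

Let discrete : measurableType _ := g_sigma_algebraType [set: set (N.-tuple R)].

(* The value +oo rules out the pieces of diameter > d, so that hausdorff_delta
   becomes an instance of the library's outer measure construction mu_ext, over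
   the discrete sigma-algebra. *)
Definition hcontrib_le s d C : \bar R :=
  if ediam C <= d%:E then hcontrib s C else +oo.

Lemma hcontrib_le_ge0 s d C : 0 <= hcontrib_le s d C.
Proof. by rewrite /hcontrib_le; case: ifP => // _; exact: hcontrib_ge0. Qed.

Lemma hausdorff_delta_mu_ext s d A :
  hausdorff_delta s d A = @mu_ext _ discrete R (hcontrib_le s d) A.
Proof.
apply/eqP; rewrite eq_le; apply/andP; split.
- apply: le_ereal_inf_tmp => _ [C [_ AC] <-].
  have [Cd|/existsNP[i Ci]] := pselect (forall i, ediam (C i) <= d%:E).
    apply: ereal_inf_lbound; exists C => //.
    by apply: eq_eseriesr => i _; rewrite /hcontrib_le Cd.
  rewrite (@eseries_pinfty _ _ xpredT i) ?leey//.
    by move=> n _; rewrite gt_eqF// (lt_le_trans _ (hcontrib_le_ge0 _ _ _)).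
  by rewrite /hcontrib_le; move/negP/negbTE: Ci => ->.
- apply: le_ereal_inf_tmp => _ [C [AC Cd] <-].
  apply: ereal_inf_lbound; exists C.
    by split => // i; exact: sub_gen_smallest.
  by apply: eq_eseriesr => i _; rewrite /hcontrib_le Cd.
Qed.

Lemma hausdorff_delta_ge0 s d A : 0 <= hausdorff_delta s d A.
Proof.
by rewrite hausdorff_delta_mu_ext mu_ext_ge0//; exact: hcontrib_le_ge0.
Qed.

Lemma hausdorff_delta_le_hausdorff s d A : (0 < d)%R ->
  hausdorff_delta s d A <= hausdorff s A.
Proof. by move=> d0; apply: ereal_sup_ubound; exists d. Qed.

Lemma hausdorff_ge0 s A : 0 <= hausdorff s A.
Proof.
by apply: le_trans (hausdorff_delta_le_hausdorff s _ A ltr01); exact: hausdorff_delta_ge0.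
Qed.

Lemma le_hausdorff s : {homo @hausdorff R N s : A B / A `<=` B >-> A <= B}.
Proof.
move=> A B AB; apply: ge_ereal_sup => _ [d /= d0 <-].
apply: le_trans (hausdorff_delta_le_hausdorff s _ B d0).
by rewrite !hausdorff_delta_mu_ext; apply: le_mu_ext.
Qed.

Lemma hausdorff0 s : hausdorff s (@set0 (N.-tuple R)) = 0.
Proof.
apply/eqP; rewrite eq_le hausdorff_ge0 andbT.
apply: ge_ereal_sup => _ [d /= d0 <-].
apply: ereal_inf_lbound; exists (fun=> set0).
  split=> [x []|_]; rewrite /ediam.
  rewrite [X in ereal_sup X](_ : _ = set0) ?ereal_sup0 ?maxeNy ?lee_fin ?ltW//.
  by apply/seteqP; split=> // _ [? []].
by rewrite eseries0// => i _ _; exact: hcontrib0.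
Qed.

Lemma hausdorff_sigma_subadditive s :
  sigma_subadditive (hausdorff s : set (N.-tuple R) -> \bar R).
Proof.
move=> F; apply: ge_ereal_sup => _ [d /= d0 <-].
rewrite hausdorff_delta_mu_ext.
apply: le_trans (@mu_ext_sigma_subadditive _ discrete R _ (hcontrib_le_ge0 s d) F) _.
apply: lee_nneseries => [i _ _|i _]; first by apply: mu_ext_ge0; exact: hcontrib_le_ge0.
by rewrite -hausdorff_delta_mu_ext; exact: hausdorff_delta_le_hausdorff.
Qed.

(** Makes the lemmas on integrals against an arbitrary outer measure applicable to [cx_mass]. *)
HB.instance Definition _ s := isOuterMeasure.Build R (N.-tuple R) (hausdorff s)
  (hausdorff0 s) (hausdorff_ge0 s) (@le_hausdorff s)
  (hausdorff_sigma_subadditive s).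

Lemma bigcup_hausdorff0 s (F : (set (N.-tuple R))^nat) :
  (forall i, hausdorff s (F i) = 0) -> hausdorff s (\bigcup_i F i) = 0.
Proof.
move=> F0; apply/eqP; rewrite eq_le hausdorff_ge0 andbT.
apply: le_trans (hausdorff_sigma_subadditive s F) _.
by rewrite eseries0.
Qed.

Lemma sub_hausdorff0 s A B : A `<=` B -> hausdorff s B = 0 -> hausdorff s A = 0.
Proof.
move=> /(le_hausdorff s) AB B0; apply/eqP.
by rewrite eq_le hausdorff_ge0 andbT -B0.
Qed.

End HausdorffOuterMeasure.

(** * Lower bound on the dimension *)

Lemma lebesgue_measure_segment {R : realType} (x y : R) : x <= y ->
  lebesgue_measure `[x, y]%classic = (y - x)%:E.
Proof.
move=> xy; rewrite lebesgue_measure_itv/= lte_fin.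
by case: ltP => [_|yx]; rewrite -?EFinB//; congr EFin; apply/eqP; lra.
Qed.

Lemma nneseries_ge_term {R : realType} (u : nat -> \bar R) (i : nat) :
  (forall j, 0 <= u j)%E -> (u i <= \sum_(j <oo) u j)%E.
Proof.
move=> u0; rewrite (@nneseriesD1 _ _ i)//.
by rewrite leeDl// nneseries_ge0.
Qed.

(* The weights make the induction go through: integrating the hypothesis over
   the coordinate j turns w i into w i * (b i j - a i j). *)
Lemma weighted_box_cover {R : realType} (I : eqType) (c : I -> R) (e : R)
    (a b : nat -> I -> R) (s : seq I) (w : nat -> R) (K : R) :
  0 <= e -> (forall i j, a i j <= b i j) -> uniq s -> (forall i, 0 <= w i) ->
  0 <= K ->
  (forall p : I -> R, (forall j, c j <= p j <= c j + e) ->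
    (K%:E <= \sum_(i <oo)
       (w i * \prod_(j <- s) \1_(`[a i j, b i j]%classic) (p j))%:E)%E) ->
  ((K * e ^+ size s)%:E <=
    \sum_(i <oo) (w i * \prod_(j <- s) (b i j - a i j))%:E)%E.
Proof.
move=> e0 ab; elim: s w K => [|j s IH] w K /= => [_|/andP[js us]] w0 K0 H.
  have /H : forall j, c j <= c j <= c j + e by move=> j; rewrite lexx lerDl.
  by rewrite expr0 mulr1; under eq_eseriesr do rewrite big_nil;
    under [X in _ -> (_ <= X)%E]eq_eseriesr do rewrite big_nil.
rewrite exprS mulrA.
under eq_eseriesr do rewrite big_cons mulrA.
apply: IH => //.
- by move=> i; rewrite mulr_ge0// subr_ge0.
- by rewrite mulr_ge0.
move=> p cp.
pose v i : R := w i * \prod_(k <- s) \1_(`[a i k, b i k]%classic) (p k).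
have v0 i : 0 <= v i.
  by rewrite mulr_ge0// prodr_ge0// => k _; rewrite indicE.
pose D : set R := `[c j, c j + e]%classic.
have mD : measurable D by exact: measurable_itv.
have mf i : measurable_fun D
    (fun t : R => ((v i)%:E * (\1_(`[a i j, b i j]%classic) t)%:E)%E).
  apply/measurable_EFinP => /=; apply: measurable_funM => //.
have Kt (t : R) : D t ->
    (K%:E <= \sum_(i <oo) ((v i)%:E * (\1_(`[a i j, b i j]%classic) t)%:E))%E.
  move=> Dt; have /H : forall k, c k <= (if k == j then t else p k) <= c k + e.
    by move=> k; case: eqP => [->|_//]; move: Dt; rewrite /D/= in_itv.
  congr (_ <= _)%E; apply: eq_eseriesr => i _.
  rewrite big_cons eqxx -EFinM; congr EFin.
  rewrite /v -mulrA; congr (_ * _); rewrite mulrC; congr (_ * _).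
  apply: eq_big_seq => k ks; case: eqP => // kj.
  by rewrite -kj ks in js.
have : (\int[lebesgue_measure]_(t in D) (cst K%:E t) <=
  \int[lebesgue_measure]_(t in D)
    \sum_(i <oo) ((v i)%:E * (\1_(`[a i j, b i j]%classic) t)%:E))%E.
  apply: ge0_le_integral => //.
  apply: (@ge0_emeasurable_sum _ _ R D _ xpredT) => [i t _ _|i _ //].
  by rewrite mule_ge0// lee_fin.
rewrite integral_cst//= lebesgue_measure_segment ?lerDl// addrAC subrr add0r.
rewrite -EFinM => /le_trans; apply.
rewrite integral_nneseries//; last by move=> i t _; rewrite mule_ge0// lee_fin.
apply: lee_nneseries => [i _ _|i _].
  by apply: integral_ge0 => t _; rewrite mule_ge0// lee_fin.
rewrite ge0_integralZl_EFin//=; last first.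
  apply/measurable_EFinP; apply: measurable_indic; exact: measurable_itv.
rewrite integral_indic//.
have -> : (w i * (b i j - a i j) * \prod_(k <- s) \1_`[a i k, b i k] (p k))%:E =
    ((v i)%:E * (b i j - a i j)%:E)%E by rewrite -EFinM /v; congr EFin; ring.
apply: lee_wpmul2l; first by rewrite lee_fin.
rewrite -lebesgue_measure_segment//; apply: le_measure; rewrite ?inE//.
exact: measurableI.
Qed.

Lemma ediam_ge0 {R : realType} {N} (C : set (N.-tuple R)) : (0 <= ediam C)%E.
Proof. by rewrite /ediam le_max lexx. Qed.

Lemma ediam_fineK {R : realType} {N} (C : set (N.-tuple R)) (d : R) :
  (ediam C <= d%:E)%E -> (fine (ediam C))%:E = ediam C.
Proof.
by move=> Cd; rewrite fineK// ge0_fin_numE ?ediam_ge0// (le_lt_trans Cd)// ltry.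
Qed.

Lemma edist_le_ediam {R : realType} {N} (C : set (N.-tuple R)) (d : R) x y :
  (ediam C <= d%:E)%E -> C x -> C y -> Defs.edist x y <= fine (ediam C).
Proof.
move=> Cd Cx Cy; rewrite -lee_fin (ediam_fineK _ _ Cd) /ediam le_max.
by apply/orP; right; apply: ereal_sup_ubound; exists x => //; exists y.
Qed.

(** Each [F j] is 1-Lipschitz, so a piece of diameter d projects into a box of side 2d, and these
    boxes cover a cube of side [e]. If [s < #|I|] and d <= 1, the volume of such a box is at most
    [2 ^+ #|I|] times d^s, and nullity makes the sum of the d^s arbitrarily small. *)
Lemma hausdorff0_ge_dim {R : realType} {N : nat} (I : finType)
    (A : set (N.-tuple R)) (F : I -> N.-tuple R -> R) (c : I -> R) (e s : R) :
  0 < e -> (forall j x y, `|F j x - F j y| <= Defs.edist x y) ->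
  (forall p : I -> R, (forall j, c j <= p j <= c j + e) ->
    exists2 x, A x & forall j, F j x = p j) ->
  0 <= s -> hausdorff s A = 0%E -> #|I|%:R <= s.
Proof.
move=> e0 F1 FA s0 HA; rewrite leNgt; apply/negP => sI.
have I0 : (0 < #|I|)%N by rewrite -(@ltr_nat R) (le_lt_trans s0).
(* With this value [2 ^+ #|I| * eps] is half the volume of the cube. *)
pose eps : R := e ^+ #|I| / 2 ^+ #|I| / 2.
have eps0 : 0 < eps by rewrite !divr_gt0// exprn_gt0.
(* Scale 1, because raising the exponent from [s] to [#|I|] needs diameters at most 1. *)
have Hd0 : (hausdorff_delta s 1 A = 0)%E.
  apply/eqP; rewrite eq_le hausdorff_delta_ge0 andbT -HA.
  exact: hausdorff_delta_le_hausdorff.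
move: Hd0; rewrite /hausdorff_delta; set S := (S in ereal_inf S) => S0.
have [|_ [C [AC C1] <-]] := @lb_ereal_inf_adherent R S eps eps0.
  by rewrite S0.
rewrite S0 add0e => Clt.
pose d i : R := fine (ediam (C i)).
have d0 i : 0 <= d i by rewrite fine_ge0// ediam_ge0.
have d1 i : d i <= 1 by rewrite -lee_fin (ediam_fineK _ _ (C1 i)).
pose w i : R := (`[< C i !=set0 >])%:R.
have [x xC] : {x : nat -> N.-tuple R & forall i, C i !=set0 -> C i (x i)}.
  apply: (@choice _ _ (fun i x => C i !=set0 -> C i x)) => i.
  have [[y Cy]|nC] := pselect (C i !=set0); first by exists y.
  by exists [tuple 0 | j < N].
have cover (p : I -> R) : (forall j, c j <= p j <= c j + e) ->
    (1%:E <= \sum_(i <oo) (w i * \prod_(j <- enum I)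
       \1_(`[F j (x i) - d i, F j (x i) + d i]%classic) (p j))%:E)%E.
  move=> /FA[y /AC[i _ Ciy] Fp].
  apply: le_trans (nneseries_ge_term _ i _); last first.
    move=> k; rewrite lee_fin mulr_ge0// prodr_ge0//.
  rewrite lee_fin /w asboolT; last by exists y.
  rewrite mul1r big1// => j _; rewrite indicE mem_set//=.
  have Cix : C i (x i) by apply: xC; exists y.
  have := le_trans (F1 j y (x i)) (edist_le_ediam _ _ _ _ (C1 i) Ciy Cix).
  by rewrite in_itv/= Fp ler_distl.
have dd i (j : I) : F j (x i) - d i <= F j (x i) + d i.
  by have := d0 i; lra.
have := weighted_box_cover I c e (fun i j => F j (x i) - d i)
  (fun i j => F j (x i) + d i) _ w 1 (ltW e0) dd
  (enum_uniq I) (fun=> ler0n _ _) ler01 cover.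
rewrite -cardE; apply/negP; rewrite mul1r -ltNge.
apply: (@le_lt_trans _ _ (\sum_(i <oo) ((2 ^+ #|I|)%:E * hcontrib s (C i)))%E).
  apply: lee_nneseries => [i _ _|i _].
    rewrite lee_fin mulr_ge0// prodr_ge0// => j _.
    by have := d0 i; lra.
  rewrite /hcontrib /w; case: ifPn => _; last by rewrite mul0r mule0.
  rewrite mul1r -EFinM lee_fin.
  rewrite (eq_bigr (fun=> 2 * d i)); last by move=> j _; ring.
  rewrite big_enum prodr_const exprMn ler_wpM2l ?exprn_ge0//.
  (* Comparing exponents needs a positive base; for diameter 0 the left side is 0 because [I] is
     nonempty. *)
  rewrite -powR_mulrn//; have := d0 i; rewrite le_eqVlt => /predU1P[<-|di].
    by rewrite powR0 ?powR_ge0// pnatr_eq0 -lt0n.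
  by apply: ger_powR; rewrite ?di ?d1// ltW.
rewrite nneseriesZl; last by move=> i _; exact: hcontrib_ge0.
have P0 : 0 < (2 : R) ^+ #|I| by rewrite exprn_gt0.
apply: (@lt_trans _ _ ((2 ^+ #|I|)%:E * eps%:E))%E.
  by rewrite lte_pmul2l.
rewrite -EFinM lte_fin /eps.
have -> : 2 ^+ #|I| * (e ^+ #|I| / 2 ^+ #|I| / 2) = e ^+ #|I| / 2 :> R.
  by field; rewrite gt_eqF.
by have : 0 < e ^+ #|I| by [rewrite exprn_gt0]; lra.
Qed.

(** * Upper bound on the dimension *)

Lemma ediam_le {R : realType} {N} (C : set (N.-tuple R)) (d : R) : 0 <= d ->
  (forall x y, C x -> C y -> Defs.edist x y <= d) -> (ediam C <= d%:E)%E.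
Proof.
move=> d0 Cd; rewrite /ediam ge_max lee_fin d0/=.
by apply: ge_ereal_sup => _ [x Cx [y Cy <-]]; rewrite lee_fin Cd.
Qed.

Lemma hcontrib_le_powR {R : realType} {N} (C : set (N.-tuple R)) (s d : R) :
  0 <= s -> (ediam C <= d%:E)%E -> (hcontrib s C <= (d `^ s)%:E)%E.
Proof.
move=> s0 Cd; rewrite /hcontrib; case: ifP => _; last by rewrite lee_fin powR_ge0.
have Cd' := Cd; rewrite -(ediam_fineK _ _ Cd) lee_fin in Cd'.
rewrite lee_fin ge0_ler_powR// nnegrE ?fine_ge0 ?ediam_ge0//.
by rewrite (le_trans _ Cd')// fine_ge0// ediam_ge0.
Qed.

Lemma ediam_set0 {R : realType} {N} (d : R) : 0 <= d ->
  (ediam (@set0 (N.-tuple R)) <= d%:E)%E.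
Proof. by move=> d0; exact: ediam_le. Qed.

Lemma hausdorff_delta_finite_cover {R : realType} {N} (T : finType)
    (C : T -> set (N.-tuple R)) (s d : R) (A : set (N.-tuple R)) : 0 <= d ->
  (forall t, ediam (C t) <= d%:E)%E -> A `<=` \bigcup_t C t ->
  (hausdorff_delta s d A <= \sum_(t : T) hcontrib s (C t))%E.
Proof.
move=> d0 Cd AC; apply: ereal_inf_lbound.
pose r := [seq C t | t <- enum T].
(* The default value pads the cover with empty sets, which contribute 0 for every [s], even
   [s = 0]. *)
exists (nth set0 r).
  split=> [x /AC[t _ Ctx]|i].
    exists (index t (enum T)) => //.
    by rewrite (nth_map t) ?index_mem ?mem_enum// nth_index// mem_enum.
  have [ir|ir] := ltnP i (size r); last by rewrite nth_default// ediam_set0.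
  by have /mapP[t _ ->] := mem_nth set0 ir.
rewrite (nneseries_split 0 (size r)); last by move=> i _; exact: hcontrib_ge0.
rewrite add0n [X in (_ + X)%E]eseries0; last first.
  by move=> i ri _; rewrite nth_default// hcontrib0.
by rewrite adde0 -(big_nth set0 xpredT (hcontrib s)) big_map big_enum.
Qed.

(** Lipschitz on every cube for the sup distance; the bound [e] stands for that distance, so that
    [I] needs no norm. Closure under sums and products covers all polynomial charts. *)
Definition locLip {R : realType} {I : Type} (F : (I -> R) -> R) : Prop :=
  forall B : R, 0 <= B -> exists2 L : R, 0 <= L & forall (x y : I -> R) (e : R),
    (forall i, `|x i| <= B) -> (forall i, `|y i| <= B) -> 0 <= e ->
    (forall i, `|x i - y i| <= e) -> `|F x - F y| <= L * e.

Section LocallyLipschitz.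
Context {R : realType} {I : Type}.
Implicit Types F G : (I -> R) -> R.

Lemma locLip_cst (c : R) : locLip (fun _ : I -> R => c).
Proof. by move=> B B0; exists 0 => // x y e *; rewrite subrr normr0 mul0r. Qed.

Lemma locLip_coord (i : I) : locLip (fun x : I -> R => x i).
Proof. by move=> B B0; exists 1 => // x y e *; rewrite mul1r. Qed.

Lemma locLipD F G : locLip F -> locLip G -> locLip (fun x => F x + G x).
Proof.
move=> FL GL B B0; have [L L0 {}FL] := FL B B0; have [M M0 {}GL] := GL B B0.
exists (L + M) => [|x y e xB yB e0 xy]; first exact: addr_ge0.
rewrite opprD addrACA mulrDl (le_trans (ler_normD _ _))// lerD//.
  exact: FL.
exact: GL.
Qed.

Lemma locLipM F G : locLip F -> locLip G -> locLip (fun x => F x * G x).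
Proof.
move=> FL GL B B0; have [L L0 {}FL] := FL B B0; have [M M0 {}GL] := GL B B0.
(* A Lipschitz function is bounded on the cube, by comparison with its value at 0, which is within
   distance [B]. *)
have bnd H K : (forall x y e, (forall i, `|x i| <= B) -> (forall i, `|y i| <= B) ->
    0 <= e -> (forall i, `|x i - y i| <= e) -> `|H x - H y| <= K * e) ->
    forall x : I -> R, (forall i, `|x i| <= B) -> `|H x| <= `|H (fun=> 0)| + K * B.
  move=> HL x xB; have -> : H x = H (fun=> 0) + (H x - H (fun=> 0)) by rewrite addrC subrK.
  rewrite (le_trans (ler_normD _ _))// lerD2l; apply: HL => // i.
    by rewrite normr0.
  by rewrite subr0.
exists ((`|F (fun=> 0)| + L * B) * M + L * (`|G (fun=> 0)| + M * B)).
  by rewrite addr_ge0 ?mulr_ge0// addr_ge0// mulr_ge0.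
move=> x y e xB yB e0 xy.
have -> : F x * G x - F y * G y = F x * (G x - G y) + (F x - F y) * G y by ring.
rewrite (le_trans (ler_normD _ _))// !normrM mulrDl; apply: lerD.
  by rewrite -mulrA ler_pM// ?bnd// GL.
by rewrite mulrAC ler_pM// ?bnd// FL.
Qed.

Lemma locLip_sum (J : Type) (r : seq J) (P : pred J) (F : J -> (I -> R) -> R) :
  (forall j, locLip (F j)) -> locLip (fun x => \sum_(j <- r | P j) F j x).
Proof.
move=> FL; elim: r => [|j r IH].
  by under eq_fun do rewrite big_nil; exact: locLip_cst.
under eq_fun do rewrite big_cons; case: (P j) => //.
exact: locLipD.
Qed.

End LocallyLipschitz.

Lemma edist_le_sup {R : realType} {N} (x y : N.-tuple R) (e : R) : 0 <= e ->
  (forall k, `|tnth x k - tnth y k| <= e) -> Defs.edist x y <= N%:R * e.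
Proof.
move=> e0 xy; rewrite /Defs.edist -[leRHS]ger0_norm ?mulr_ge0// -sqrtr_sqr.
apply: ler_wsqrtr; apply: (@le_trans _ _ (\sum_(i < N) e ^+ 2)).
  by apply: ler_sum => i _; rewrite -[leLHS]real_normK ?num_real// lerXn2r ?nnegrE.
rewrite sumr_const card_ord exprMn -(mulr_natl (e ^+ 2)) ler_wpM2r ?sqr_ge0//.
by rewrite -natrX ler_nat -mulnn; case: (N) => // n; rewrite leq_pmulr.
Qed.

Lemma interval_cell {R : realType} (B t : R) (m : nat) : 0 <= B -> `|t| <= B ->
  exists k : 'I_m.+1, - B + 2 * B / m.+1%:R * k%:R <= t <=
                      - B + 2 * B / m.+1%:R * k.+1%:R.
Proof.
move=> B0; rewrite ler_norml => /andP[Bt tB].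
(* The cell is the least [k] whose right end reaches [t]: minimality puts [t] beyond the left end,
   which for [k = 0] is [- B]. *)
have ex : exists k, t <= - B + 2 * B / m.+1%:R * k.+1%:R.
  by exists m; rewrite divfK ?pnatr_eq0//; lra.
have km : (ex_minn ex < m.+1)%N.
  case: ex_minnP => k _; apply => //.
  by rewrite divfK ?pnatr_eq0//; lra.
exists (Ordinal km) => /=; case: ex_minnP km => -[|k] tk kmin _; rewrite tk andbT.
  by rewrite mulr0 addr0.
by rewrite leNgt; apply/negP => /ltW /kmin; rewrite ltnn.
Qed.

(** Total contribution of (m+1)^D cells of diameter K/(m+1): it equals K^s (m+1)^(D-s), which tends
    to 0. *)
Lemma powR_small {R : realType} (D : nat) (s K d eps : R) :
  D%:R < s -> 0 <= K -> 0 < d -> 0 < eps ->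
  exists m : nat, K / m.+1%:R <= d /\ m.+1%:R ^+ D * (K / m.+1%:R) `^ s <= eps.
Proof.
move=> Ds K0 d0 eps0; pose t := s - D%:R; have t0 : 0 < t by rewrite subr_gt0.
(* [X] solves X^t = K^s / eps, so [m.+1] above [X] bounds the sum, and above [K / d] bounds the
   diameters. *)
pose X := (K `^ s / eps) `^ t^-1.
have X0 : 0 <= X by exact: powR_ge0.
have Y0 : 0 <= K / d + X by rewrite addr_ge0// divr_ge0// ltW.
pose m := Num.bound (K / d + X).
have mb : K / d + X < m.+1%:R.
  by rewrite (lt_trans (archi_boundP Y0))// ltr_nat.
have m0 : 0 < m.+1%:R :> R by [].
exists m; split.
  rewrite ler_pdivrMr// mulrC -ler_pdivrMr// ltW// (le_lt_trans _ mb)// lerDl//.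
have sD : s = D%:R + t by rewrite /t addrC subrK.
rewrite powRM ?invr_ge0 ?(ltW m0)// -powR_inv1 ?(ltW m0)// -powRrM mulN1r.
rewrite mulrCA -powR_mulrn ?(ltW m0)// -powRD; last by rewrite pnatr_eq0 implybT.
have -> : D%:R - s = - t by rewrite /t; ring.
rewrite powRN ler_pdivrMr ?powR_gt0//.
rewrite -ler_pdivrMl// mulrC.
have Xm : X <= m.+1%:R by rewrite ltW// (le_lt_trans _ mb)// lerDr divr_ge0// ltW.
have : X `^ t <= m.+1%:R `^ t by rewrite ge0_ler_powR ?nnegrE// ltW.
rewrite /X -powRrM mulVf ?gt_eqF// powRr1//.
by rewrite divr_ge0 ?powR_ge0// ltW.
Qed.

Lemma locLip_uniform {R : realType} {I : Type} (J : finType)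
    (F : J -> (I -> R) -> R) (B : R) : 0 <= B -> (forall j, locLip (F j)) ->
  exists2 L : R, 0 <= L & forall j (x y : I -> R) (e : R),
    (forall i, `|x i| <= B) -> (forall i, `|y i| <= B) -> 0 <= e ->
    (forall i, `|x i - y i| <= e) -> `|F j x - F j y| <= L * e.
Proof.
move=> B0 FL.
have [L HL] : {L : J -> R & forall j, 0 <= L j /\ forall (x y : I -> R) (e : R),
    (forall i, `|x i| <= B) -> (forall i, `|y i| <= B) -> 0 <= e ->
    (forall i, `|x i - y i| <= e) -> `|F j x - F j y| <= L j * e}.
  apply: (@choice _ _ (fun j L => 0 <= L /\ forall (x y : I -> R) (e : R),
    (forall i, `|x i| <= B) -> (forall i, `|y i| <= B) -> 0 <= e ->
    (forall i, `|x i - y i| <= e) -> `|F j x - F j y| <= L * e)) => j.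
  by have [L L0 HL] := FL j B B0; exists L.
exists (\sum_j L j); first by apply: sumr_ge0 => j _; have [] := HL j.
move=> j x y e xB yB e0 xy; have [_ /(_ x y e xB yB e0 xy)] := HL j.
move=> /le_trans; apply; rewrite ler_wpM2r//.
by rewrite (bigD1 j)//= lerDl sumr_ge0// => k _; have [] := HL k.
Qed.

(** Cut the cube of half-side [B] into (m+1)^#|I| cells of side 2B/(m+1). The image of a cell has
    diameter at most N L times that side, where N compares the Euclidean and sup distances;
    [powR_small] concludes, and the cubes exhaust the parameter space. *)
Lemma hausdorff_locLip_image0 {R : realType} {N : nat} (I : finType)
    (Phi : (I -> R) -> N.-tuple R) (s : R) :
  (forall k, locLip (fun p => tnth (Phi p) k)) -> #|I|%:R < s ->
  hausdorff s (range Phi) = 0%E.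
Proof.
move=> PhiL Is; have s0 : 0 <= s by rewrite (le_trans _ (ltW Is)).
have bounded_image0 (B : nat) :
    hausdorff s (Phi @` [set p | forall i, `|p i| <= B%:R]) = 0%E.
  apply/eqP; rewrite eq_le hausdorff_ge0 andbT.
  apply: ge_ereal_sup => _ [d /= d0 <-].
  apply/lee_addgt0Pr => eps eps0; rewrite add0e.
  have B0 : 0 <= B%:R :> R by [].
  have [L L0 HL] := locLip_uniform _ _ _ B0 PhiL.
  have K0 : 0 <= N%:R * (L * (2 * B%:R)) by rewrite !mulr_ge0.
  have [m [md meps]] := powR_small _ _ _ _ _ Is K0 d0 eps0.
  set K := N%:R * _ in K0 md meps.
  pose h : R := 2 * B%:R / m.+1%:R.
  have h0 : 0 <= h by rewrite divr_ge0// mulr_ge0.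
  pose cell (f : {ffun I -> 'I_m.+1}) := Phi @` [set p | forall i,
    `|p i| <= B%:R /\ - B%:R + h * (f i)%:R <= p i <= - B%:R + h * (f i).+1%:R].
  have cellK f : (ediam (cell f) <= (K / m.+1%:R)%:E)%E.
    apply: ediam_le => [|_ _ [p pf <-] [q qf <-]]; first by rewrite divr_ge0.
    have -> : K / m.+1%:R = N%:R * (L * h) by rewrite /K /h; ring.
    apply: edist_le_sup => [|k]; first exact: mulr_ge0.
    apply: HL => // i; first by have [] := pf i.
      by have [] := qf i.
    have [_ /andP[p1 p2]] := pf i; have [_ /andP[q1 q2]] := qf i.
    by rewrite ler_norml; move: p1 p2 q1 q2; rewrite -natr1; lra.
  have celld f : (ediam (cell f) <= d%:E)%E by rewrite (le_trans (cellK f))// lee_fin.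
  apply: le_trans (hausdorff_delta_finite_cover _ _ s _ _ (ltW d0) celld _) _.
    move=> _ [p /= pB <-].
    have [f Hf] := @choice _ _ (fun i (k : 'I_m.+1) => - B%:R + h * k%:R <= p i <=
      - B%:R + h * k.+1%:R) (fun i => interval_cell _ _ m B0 (pB i)).
    exists [ffun i => f i] => //; exists p => //= i; split => //.
    by rewrite ffunE; exact: Hf.
  apply: (@le_trans _ _ (\sum_(f : {ffun I -> 'I_m.+1}) ((K / m.+1%:R) `^ s)%:E)%E).
    by apply: lee_sum => f _; exact: hcontrib_le_powR.
  rewrite sumEFin lee_fin sumr_const card_ffun card_ord -(mulr_natl (_ `^ s)) natrX.
  exact: meps.
apply: sub_hausdorff0 (bigcup_hausdorff0 _ _ bounded_image0) => _ [p _ <-].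
exists (Num.bound (\sum_i `|p i|)) => //; exists p => //= i.
rewrite ltW// (le_lt_trans _ (archi_boundP (sumr_ge0 _ _)))//.
by rewrite (bigD1 i)//= lerDl sumr_ge0.
Qed.

(** * Charts for matrices of given rank *)

(** Serves to move a chosen set of pivot rows to the top. *)
Lemma inj_extend_perm (r c : nat) (f : 'I_r -> 'I_(r + c)) : injective f ->
  exists s : 'S_(r + c), forall i, s (lshift c i) = f i.
Proof.
move=> f_inj; pose X := [set f i | i : 'I_r].
have cX : #|~: X| = c.
  by rewrite cardsCs finset.setCK card_imset// !card_ord addKn.
pose h (j : 'I_(r + c)) : 'I_(r + c) := match fintype.split j with
  | inl i => f i | inr i => enum_val (cast_ord (esym cX) i) end.
have hX (i : 'I_c) : enum_val (cast_ord (esym cX) i) \notin X.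
  by have := enum_valP (cast_ord (esym cX) i); rewrite inE.
have h_inj : injective h.
  move=> j k; rewrite /h; case: (fintype.splitP j) => i ji; case: (fintype.splitP k) => l kl.
  - by move/f_inj => il; apply: val_inj; rewrite /= ji kl il.
  - by move=> fil; have := hX l; rewrite -fil imset_f.
  - by move=> fil; have := hX i; rewrite fil imset_f.
  - by move/enum_val_inj/cast_ord_inj => il; apply: val_inj; rewrite /= ji kl il.
exists (perm h_inj) => i.
by rewrite permE /h -[lshift c i]/(unsplit (inl i)) unsplitK.
Qed.

Section RankCharts.
Context {F : fieldType}.

Lemma rank_factor (m n r : nat) (A : 'M[F]_(m, n)) : \rank A = r ->
  exists (L : 'M[F]_(m, r)) (U : 'M[F]_(r, n)), [/\ A = L *m U, row_full L & row_free U].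
Proof.
move=> <-; exists (col_base A), (row_base A).
by rewrite mulmx_base col_base_full row_base_free.
Qed.

(** [L] has [r] independent rows; moved to the top they form the invertible [B], which is then
    factored out on the right. *)
Lemma row_full_chart (r c : nat) (L : 'M[F]_(r + c, r)) : row_full L ->
  exists (s : 'S_(r + c)) (S : 'M[F]_(c, r)) (B : 'M[F]_r),
    B \in unitmx /\ L = perm_mx s *m col_mx 1%:M S *m B.
Proof.
move=> Lfull; have [s Hs] := inj_extend_perm _ _ _ (@fullrankfun_inj _ _ _ _ Lfull).
pose L' := row_perm s L; pose B := usubmx L'.
have BE : B = rowsub (fullrankfun Lfull) L.
  by apply/matrixP => i j; rewrite !mxE Hs.
have Bu : B \in unitmx by rewrite BE fullrowsub_unit.
exists (s^-1)%g, (dsubmx L' *m invmx B), B; split=> //.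
rewrite -mulmxA mul_col_mx mul1mx mulmxKV// vsubmxK /L' row_permE mulmxA.
by rewrite -perm_mxM mulVg perm_mx1 mul1mx.
Qed.

(** [row_full_chart] applied to the left factor and to the transpose of the right factor of a rank
    factorization; the two square blocks merge into [B]. *)
Lemma rank_chart (r c c' : nat) (A : 'M[F]_(r + c, r + c')) : \rank A = r ->
  exists (s : 'S_(r + c)) (t : 'S_(r + c')) (S : 'M[F]_(c, r)) (B : 'M[F]_r)
      (T : 'M[F]_(r, c')),
    B \in unitmx /\
    A = perm_mx s *m col_mx 1%:M S *m B *m row_mx 1%:M T *m perm_mx t.
Proof.
move=> /rank_factor[L [U [-> /row_full_chart[s [S [B [Bu ->]]]] Ufree]]].
have /row_full_chart[t [T [C [Cu UE]]]] : row_full U^T.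
  by rewrite /row_full mxrank_tr.
exists s, t^-1%g, S, (B *m C^T), T^T; split.
  by rewrite unitmx_mul Bu unitmx_tr.
rewrite -(trmxK U) UE !trmx_mul tr_col_mx trmx1 tr_perm_mx.
by rewrite !mulmxA.
Qed.

(** The kernel of (1 | T) consists of the columns (-T w; w), so [X] is determined by the lower part
    [W] of its permuted rows. [W] keeps the rank of [X] and its annihilation relations, so it can
    replace the next differential. *)
Lemma chart_kernel (r c c' n : nat) (s : 'S_(r + c)) (t : 'S_(r + c'))
    (S : 'M[F]_(c, r)) (B : 'M[F]_r) (T : 'M[F]_(r, c')) (X : 'M[F]_(r + c', n)) :
  B \in unitmx ->
  perm_mx s *m col_mx 1%:M S *m B *m row_mx 1%:M T *m perm_mx t *m X = 0 ->
  exists W : 'M[F]_(c', n), [/\ X = perm_mx t^-1 *m col_mx (- T) 1%:M *m W,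
    \rank W = \rank X & forall q (Y : 'M[F]_(n, q)), X *m Y = 0 -> W *m Y = 0].
Proof.
move=> Bu; pose X' := perm_mx t *m X.
have XE : X = perm_mx t^-1 *m X' by rewrite mulmxA -perm_mxM mulVg perm_mx1 mul1mx.
rewrite -!mulmxA -/X' => X0.
have {X0} : row_mx 1%:M T *m X' = 0.
  (* The multiplier is a left inverse of [perm_mx s *m col_mx 1%:M S *m B]. *)
  have := congr1 (mulmx (invmx B *m row_mx 1%:M 0 *m perm_mx s^-1)) X0.
  rewrite mulmx0 -!mulmxA (mulmxA (perm_mx s^-1)) -perm_mxM mulVg perm_mx1 mul1mx.
  by rewrite (mulmxA (row_mx 1%:M 0)) mul_row_col mul1mx mul0mx addr0 mul1mx mulKmx.
rewrite -[X']vsubmxK mul_row_col mul1mx => /eqP; rewrite addr_eq0 => /eqP UE.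
have X'E : X' = col_mx (- T) 1%:M *m dsubmx X'.
  by rewrite -{1}[X']vsubmxK UE mul_col_mx mul1mx mulNmx.
have WE : dsubmx X' = row_mx 0 1%:M *m perm_mx t *m X.
  by rewrite -mulmxA -/X' -{2}[X']vsubmxK mul_row_col mul0mx mul1mx add0r.
exists (dsubmx X'); split.
- by rewrite -mulmxA -X'E.
- apply/eqP; rewrite eqn_leq {1}WE mxrankM_maxr /=.
  by rewrite {1}XE {1}X'E mulmxA mxrankM_maxr.
- move=> q Y XY; rewrite WE.
by rewrite -!mulmxA; move: XY => /= ->; rewrite !mulmx0.
Qed.

Lemma leq_rank_minor (m n k : nat) (A : 'M[F]_(m, n)) (f : 'I_k -> 'I_m)
  (g : 'I_k -> 'I_n) : \det (mxsub f g A) != 0 -> (k <= \rank A)%N.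
Proof.
rewrite -unitfE -[_ \is a _]/(mxsub f g A \in unitmx) -row_free_unit => /eqP {1}<-.
rewrite mxsubrc rowsubE (leq_trans (mxrankM_maxr _ _))// -mxrank_tr trmx_mxsub.
by rewrite rowsubE (leq_trans (mxrankM_maxr _ _))// mxrank_tr.
Qed.

(** With [leq_rank_minor], this turns rank conditions into conditions on minors; [{ffun _}] makes
    the choices of minors a finite type, as the measurability proof requires. *)
Lemma rank_minor (m n r : nat) (A : 'M[F]_(m, n)) : \rank A = r ->
  exists (f : {ffun 'I_r -> 'I_m}) (g : {ffun 'I_r -> 'I_n}),
    \det (mxsub f g A) != 0.
Proof.
move=> /rank_factor[L [U [-> Lfull Ufree]]].
have Ufull : row_full U^T by rewrite /row_full mxrank_tr.
exists (fullrankfun Lfull), (fullrankfun Ufull).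
have -> : mxsub (fullrankfun Lfull) (fullrankfun Ufull) (L *m U) =
    rowsub (fullrankfun Lfull) L *m (rowsub (fullrankfun Ufull) U^T)^T.
  by rewrite mxsub_mul; congr (_ *m _); apply/matrixP => i j; rewrite !mxE.
rewrite det_mulmx det_tr mulf_neq0// -unitfE -[_ \is a _]/(_ \in unitmx).
  exact: fullrowsub_unit.
exact: fullrowsub_unit.
Qed.

End RankCharts.

(** If [v *m A = 0] then v = - v (A - 1), so every entry of [v] is at most [eta] times its l1 norm;
    summing the [n] entries contradicts [n%:R * eta < 1] unless [v = 0]. *)
Lemma near_id_unitmx (R : realFieldType) (n : nat) (A : 'M[R]_n) (eta : R) :
  (forall i j, `|A i j - (i == j)%:R| <= eta) -> n%:R * eta < 1 -> A \in unitmx.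
Proof.
move=> Aeta neta; rewrite -row_free_unit -kermx_eq0; apply/negPn/negP => K0.
pose v := nz_row (kermx A).
have v0 : v != 0 by rewrite nz_row_eq0.
have vA : v *m A = 0 by apply/sub_kermxP; exact: nz_row_sub.
have vj j : `|v 0 j| <= eta * \sum_i `|v 0 i|.
  have -> : v 0 j = - \sum_i v 0 i * (A i j - (i == j)%:R).
    under eq_bigr do rewrite mulrBr.
    rewrite sumrB; have := congr1 (fun w : 'rV[R]_n => w 0 j) vA; rewrite !mxE => ->.
    rewrite sub0r opprK (bigD1 j)//= eqxx mulr1 big1 ?addr0// => i /negbTE ->.
    by rewrite mulr0.
  rewrite normrN (le_trans (ler_norm_sum _ _ _))// mulr_sumr ler_sum// => i _.
  by rewrite normrM mulrC ler_wpM2r.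
have S0 : 0 < \sum_i `|v 0 i|.
  rewrite lt_def sumr_ge0// andbT; apply: contra v0 => /eqP S0.
  apply/eqP/rowP => j; rewrite mxE; apply/eqP; rewrite -normr_eq0.
  by have := vj j; rewrite S0 mulr0 => ?; rewrite eq_le normr_ge0 andbT.
have : \sum_i `|v 0 i| <= \sum_(i < n) eta * \sum_i `|v 0 i| by exact: ler_sum.
by rewrite sumr_const card_ord -(mulr_natl (eta * _)) mulrA ler_pMl// leNgt neta.
Qed.

(** * Coordinates of complexes *)

Lemma bigcup_countable_hausdorff0 {R : realType} {N : nat} (T : countType) (s : R)
    (F : T -> set (N.-tuple R)) :
  (forall t, hausdorff s (F t) = 0%E) -> hausdorff s (\bigcup_t F t) = 0%E.
Proof.
move=> F0; pose G n := if unpickle n is Some t then F t else set0.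
apply: (@sub_hausdorff0 _ _ _ _ (\bigcup_n G n)).
  by move=> x [t _ Ftx]; exists (pickle t) => //; rewrite /G pickleK.
apply: bigcup_hausdorff0 => n; rewrite /G.
by case: unpickle => [t|]; [exact: F0|exact: hausdorff0].
Qed.

(* Inverse of the row-major indexing in mat_d1, mat_d2, mat_d3. *)
Definition mxcoord {R : realType} {m n : nat} (d : 'M[R]_(m, n)) (k : nat) : R :=
  if insub (k %/ n)%N is Some i then
    if insub (k %% n)%N is Some j then d i j else 0
  else 0.

Lemma mxcoord_mulnD {R : realType} {m n : nat} (d : 'M[R]_(m, n)) (i : 'I_m) (j : 'I_n) :
  mxcoord d (i * n + j) = d i j.
Proof.
have n0 : (0 < n)%N by case: (n) j => // -[].
by rewrite /mxcoord divnMDl// divn_small// addn0 modnMDl modn_small// !valK.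
Qed.

Lemma mxcoord_nth {R : realType} {m n : nat} (f : nat -> R) (k : nat) : (k < m * n)%N ->
  mxcoord (\matrix_(i < m, j < n) f (i * n + j)%N) k = f k.
Proof.
move=> kmn; have n0 : (0 < n)%N by case: (n) kmn; rewrite ?muln0.
have im : (k %/ n < m)%N by rewrite ltn_divLR.
have jn : (k %% n < n)%N by rewrite ltn_mod.
by rewrite /mxcoord !insubT mxE /= -divn_eq.
Qed.

Section ComplexTuple.
Context {R : realType} {a0 a1 a2 a3 : nat}.

Definition cx_tuple (d1 : 'M[R]_(a0, a1)) (d2 : 'M[R]_(a1, a2)) (d3 : 'M[R]_(a2, a3)) :
    (dimN a0 a1 a2 a3).-tuple R :=
  [tuple if (k < a0 * a1)%N then mxcoord d1 k
         else if (k < a0 * a1 + a1 * a2)%N then mxcoord d2 (k - a0 * a1)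
         else mxcoord d3 (k - (a0 * a1 + a1 * a2)) | k < dimN a0 a1 a2 a3].

Lemma nth_cx_tuple d1 d2 d3 (k : nat) : (k < dimN a0 a1 a2 a3)%N ->
  nth 0 (cx_tuple d1 d2 d3) k =
    if (k < a0 * a1)%N then mxcoord d1 k
    else if (k < a0 * a1 + a1 * a2)%N then mxcoord d2 (k - a0 * a1)
    else mxcoord d3 (k - (a0 * a1 + a1 * a2)).
Proof.
move=> kN; have -> : k = Ordinal kN by [].
by rewrite -tnth_nth tnth_mktuple.
Qed.

Lemma mulnD_lt (m n : nat) (i : 'I_m) (j : 'I_n) : (i * n + j < m * n)%N.
Proof.
by rewrite (@leq_trans (i.+1 * n))// ?leq_mul2r ?ltn_ord ?orbT// mulSn addnC ltn_add2r.
Qed.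

Lemma mat_d1_cx_tuple d1 d2 d3 : mat_d1 (cx_tuple d1 d2 d3) = d1.
Proof.
apply/matrixP => i j; rewrite mxE.
have ij := mulnD_lt _ _ i j; rewrite nth_cx_tuple; last first.
  by rewrite /dimN -addnA (leq_trans ij)// leq_addr.
by rewrite ij mxcoord_mulnD.
Qed.

Lemma mat_d2_cx_tuple d1 d2 d3 : mat_d2 (cx_tuple d1 d2 d3) = d2.
Proof.
apply/matrixP => i j; rewrite mxE -addnA.
have ij := mulnD_lt _ _ i j; rewrite nth_cx_tuple; last first.
  by rewrite /dimN -addnA ltn_add2l (leq_trans ij)// leq_addr.
by rewrite ltnNge leq_addr/= ltn_add2l ij addKn mxcoord_mulnD.
Qed.

Lemma mat_d3_cx_tuple d1 d2 d3 : mat_d3 (cx_tuple d1 d2 d3) = d3.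
Proof.
apply/matrixP => i j; rewrite mxE -addnA.
have ij := mulnD_lt _ _ i j; rewrite nth_cx_tuple; last first.
  by rewrite /dimN ltn_add2l.
rewrite ltnNge -addnA leq_addr/= addnA ltnNge leq_addr/= addKn.
by rewrite mxcoord_mulnD.
Qed.

Lemma cx_tuple_mat (x : (dimN a0 a1 a2 a3).-tuple R) :
  cx_tuple (mat_d1 x) (mat_d2 x) (mat_d3 x) = x.
Proof.
apply: eq_from_tnth => k; rewrite tnth_mktuple (tnth_nth 0).
case: ltnP => k1; first by rewrite (mxcoord_nth (nth 0 x)).
case: ltnP => k2.
  rewrite -[in RHS](subnKC k1) /mat_d2.
  under eq_mx do rewrite -addnA.
  rewrite (mxcoord_nth (fun l => nth 0 x (a0 * a1 + l)%N))//.
  by rewrite ltn_subLR.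
rewrite -[in RHS](subnKC k2) /mat_d3.
under eq_mx do rewrite -addnA.
rewrite (mxcoord_nth (fun l => nth 0 x (a0 * a1 + a1 * a2 + l)%N))//.
by rewrite ltn_subLR// (ltn_ord k).
Qed.

Lemma nth_edist (x y : (dimN a0 a1 a2 a3).-tuple R) (k : nat) :
  `|nth 0 x k - nth 0 y k| <= Defs.edist x y.
Proof.
have [kN|kN] := ltnP k (dimN a0 a1 a2 a3); last first.
  by rewrite !nth_default ?size_tuple// subrr normr0 sqrtr_ge0.
have -> : k = Ordinal kN by []; rewrite -!tnth_nth -sqrtr_sqr.
apply: ler_wsqrtr; rewrite (bigD1 (Ordinal kN))//= lerDl.
by apply: sumr_ge0 => i _; exact: sqr_ge0.
Qed.

End ComplexTuple.

Definition locLipmx {R : realType} {I : Type} {m n : nat} (F : (I -> R) -> 'M[R]_(m, n)) :=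
  forall i j, locLip (fun p => F p i j).

Section LocallyLipschitzMatrices.
Context {R : realType} {I : Type}.

Lemma locLip_ext (F G : (I -> R) -> R) : F =1 G -> locLip G -> locLip F.
Proof. by move=> /funext ->. Qed.

Lemma locLipmx_cst {m n} (A : 'M[R]_(m, n)) : locLipmx (fun _ : I -> R => A).
Proof. by move=> i j; exact: locLip_cst. Qed.

Lemma locLipmxN {m n} (F : (I -> R) -> 'M[R]_(m, n)) :
  locLipmx F -> locLipmx (fun p => - F p).
Proof.
move=> FL i j; apply: (locLip_ext _ (fun p => (-1) * F p i j)).
  by move=> p; rewrite mxE mulN1r.
by apply: locLipM => //; exact: locLip_cst.
Qed.

Lemma locLipmxM {m n q} (F : (I -> R) -> 'M[R]_(m, n)) (G : (I -> R) -> 'M[R]_(n, q)) :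
  locLipmx F -> locLipmx G -> locLipmx (fun p => F p *m G p).
Proof.
move=> FL GL i j; apply: (locLip_ext _ (fun p => \sum_k F p i k * G p k j)).
  by move=> p; rewrite mxE.
by apply: locLip_sum => k; exact: locLipM.
Qed.

Lemma locLip_col_mx {m1 m2 n} (F : (I -> R) -> 'M[R]_(m1, n)) (G : (I -> R) -> 'M[R]_(m2, n)) :
  locLipmx F -> locLipmx G -> locLipmx (fun p => col_mx (F p) (G p)).
Proof.
move=> FL GL i j; case: (split_ordP i) => k ->.
  by apply: (locLip_ext _ (fun p => F p k j)) => // p; rewrite col_mxEu.
by apply: (locLip_ext _ (fun p => G p k j)) => // p; rewrite col_mxEd.
Qed.

Lemma locLip_row_mx {m n1 n2} (F : (I -> R) -> 'M[R]_(m, n1)) (G : (I -> R) -> 'M[R]_(m, n2)) :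
  locLipmx F -> locLipmx G -> locLipmx (fun p => row_mx (F p) (G p)).
Proof.
move=> FL GL i j; case: (split_ordP j) => k ->.
  by apply: (locLip_ext _ (fun p => F p i k)) => // p; rewrite row_mxEl.
by apply: (locLip_ext _ (fun p => G p i k)) => // p; rewrite row_mxEr.
Qed.

Lemma locLip_mxcoord {m n} (F : (I -> R) -> 'M[R]_(m, n)) (k : nat) :
  locLipmx F -> locLip (fun p => mxcoord (F p) k).
Proof.
move=> FL; rewrite /mxcoord; case: insub => [i|]; last exact: locLip_cst.
by case: insub => [j|]; [exact: FL|exact: locLip_cst].
Qed.

Lemma locLip_cx_tuple {a0 a1 a2 a3} (F1 : (I -> R) -> 'M[R]_(a0, a1))
    (F2 : (I -> R) -> 'M[R]_(a1, a2)) (F3 : (I -> R) -> 'M[R]_(a2, a3)) k :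
  locLipmx F1 -> locLipmx F2 -> locLipmx F3 ->
  locLip (fun p => tnth (cx_tuple (F1 p) (F2 p) (F3 p)) k).
Proof.
move=> L1 L2 L3; rewrite /cx_tuple.
under eq_fun do rewrite tnth_mktuple.
by case: ltnP => _; [|case: ltnP => _]; exact: locLip_mxcoord.
Qed.

End LocallyLipschitzMatrices.

(** * Parameters and charts of the rank strata *)

Definition block_idx (r c c' : nat) : finType :=
  ('I_c * 'I_r + 'I_r * 'I_r + 'I_r * 'I_c')%type.

(** The [c0, ..., c3] are the Betti numbers: ker d1 has dimension [r2 + c1] and ker d2 has dimension
    [r3 + c2], whence the block sizes. The cardinal is D(r). *)
Definition cx_idx (r1 c0 r2 c1 r3 c2 c3 : nat) : finType :=
  (block_idx r1 c0 (r2 + c1) + block_idx r2 c1 (r3 + c2) + block_idx r3 c2 c3)%type.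

(* A stratum chart is parametrized by one block_idx per differential: the blocks
   S, B, T of a matrix P * (1; S) * B * (1 | T) * Q of rank r, whose kernel is
   the image of Q^-1 * (-T; 1). *)
Section Blocks.
Context {R : realType} {r c c' : nat}.
Implicit Types p : block_idx r c c' -> R.

Definition blockS p : 'M[R]_(c, r) := \matrix_(i, j) p (inl (inl (i, j))).
Definition blockB p : 'M[R]_r := \matrix_(i, j) p (inl (inr (i, j))).
Definition blockT p : 'M[R]_(r, c') := \matrix_(i, j) p (inr (i, j)).

Definition block_param (S : 'M[R]_(c, r)) (B : 'M[R]_r) (T : 'M[R]_(r, c'))
    (k : block_idx r c c') : R :=
  match k with
  | inl (inl ij) => S ij.1 ij.2
  | inl (inr ij) => B ij.1 ij.2
  | inr ij => T ij.1 ij.2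
  end.

Lemma block_paramK S B T : [/\ blockS (block_param S B T) = S,
  blockB (block_param S B T) = B & blockT (block_param S B T) = T].
Proof. by split; apply/matrixP => i j; rewrite mxE. Qed.

Definition chart (s : 'S_(r + c)) (t : 'S_(r + c')) p : 'M[R]_(r + c, r + c') :=
  perm_mx s *m col_mx 1%:M (blockS p) *m blockB p *m row_mx 1%:M (blockT p) *m perm_mx t.

Definition kernel_chart (t : 'S_(r + c')) p : 'M[R]_(r + c', c') :=
  perm_mx t^-1 *m col_mx (- blockT p) 1%:M.

End Blocks.

Section BlocksLipschitz.
Context {R : realType} {I : Type} {r c c' : nat} (h : block_idx r c c' -> I).

Lemma locLip_chart (s : 'S_(r + c)) (t : 'S_(r + c')) :
  locLipmx (fun p : I -> R => chart s t (p \o h)).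
Proof.
have entry m n (k : 'I_m -> 'I_n -> block_idx r c c') :
    locLipmx (fun p : I -> R => \matrix_(i, j) (p \o h) (k i j)).
  by move=> i j; under eq_fun do rewrite mxE; exact: locLip_coord.
apply: locLipmxM; last exact: locLipmx_cst.
apply: locLipmxM; last by apply: locLip_row_mx; [exact: locLipmx_cst|exact: entry].
apply: locLipmxM; last exact: entry.
apply: locLipmxM; first exact: locLipmx_cst.
by apply: locLip_col_mx; [exact: locLipmx_cst|exact: entry].
Qed.

Lemma locLip_kernel_chart (t : 'S_(r + c')) :
  locLipmx (fun p : I -> R => kernel_chart t (p \o h)).
Proof.
apply: locLipmxM; first exact: locLipmx_cst.
apply: locLip_col_mx; last exact: locLipmx_cst.
by apply: locLipmxN => i j; under eq_fun do rewrite mxE; exact: locLip_coord.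
Qed.

End BlocksLipschitz.

Section Strata.
Context {R : realType} (r1 c0 r2 c1 r3 c2 c3 : nat).
Let a0 := (r1 + c0)%N.
Let a1 := (r1 + (r2 + c1))%N.
Let a2 := (r2 + (r3 + c2))%N.
Let a3 := (r3 + c3)%N.
Let idx := cx_idx r1 c0 r2 c1 r3 c2 c3.

Definition idx1 (k : block_idx r1 c0 (r2 + c1)) : idx := inl (inl k).
Definition idx2 (k : block_idx r2 c1 (r3 + c2)) : idx := inl (inr k).
Definition idx3 (k : block_idx r3 c2 c3) : idx := inr k.

Definition cx_chart (w : 'S_(r1 + c0) * 'S_(r1 + (r2 + c1)) * ('S_(r2 + c1) *
    'S_(r2 + (r3 + c2))) * ('S_(r3 + c2) * 'S_(r3 + c3))) (p : idx -> R) :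
    (dimN a0 a1 a2 a3).-tuple R :=
  let: (s1, t1, (s2, t2), (s3, t3)) := w in
  cx_tuple (chart s1 t1 (p \o idx1))
    (kernel_chart t1 (p \o idx1) *m chart s2 t2 (p \o idx2))
    (kernel_chart t2 (p \o idx2) *m chart s3 t3 (p \o idx3)).

(** After charting d1, [chart_kernel] replaces d2 by its coordinates [W] in ker d1. As [W] has the
    rank of d2 and still kills d3, the same step applies to [W] and d3. *)
Lemma stratum_sub_charts : [set x | @chain_complexes R a0 a1 a2 a3 x /\
    [/\ \rank (mat_d1 x) = r1, \rank (mat_d2 x) = r2 & \rank (mat_d3 x) = r3]]
  `<=` \bigcup_w range (cx_chart w).
Proof.
move=> x [[d12 d23] [rk1 rk2 rk3]].
have [s1 [t1 [S1 [B1 [T1 [B1u E1]]]]]] := rank_chart _ _ _ _ rk1.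
move: (d12); rewrite E1 => /(chart_kernel _ _ _ _ _ _ _ _ _ _ B1u)[W [E2 rkW Wk]].
rewrite rk2 in rkW; have {}Wk := Wk _ _ d23.
have [s2 [t2 [S2 [B2 [T2 [B2u EW]]]]]] := rank_chart _ _ _ _ rkW.
move: Wk; rewrite EW => /(chart_kernel _ _ _ _ _ _ _ _ _ _ B2u)[Z [E3 rkZ _]].
rewrite rk3 in rkZ.
have [s3 [t3 [S3 [B3 [T3 [_ EZ]]]]]] := rank_chart _ _ _ _ rkZ.
exists (s1, t1, (s2, t2), (s3, t3)) => //.
pose q (k : idx) := match k with
  | inl (inl k) => block_param S1 B1 T1 k
  | inl (inr k) => block_param S2 B2 T2 k
  | inr k => block_param S3 B3 T3 k end.
have [eS1 eB1 eT1] : [/\ blockS (q \o idx1) = S1, blockB (q \o idx1) = B1 &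
  blockT (q \o idx1) = T1] by exact: block_paramK.
have [eS2 eB2 eT2] : [/\ blockS (q \o idx2) = S2, blockB (q \o idx2) = B2 &
  blockT (q \o idx2) = T2] by exact: block_paramK.
have [eS3 eB3 eT3] : [/\ blockS (q \o idx3) = S3, blockB (q \o idx3) = B3 &
  blockT (q \o idx3) = T3] by exact: block_paramK.
exists q => //; rewrite -[RHS]cx_tuple_mat /cx_chart /chart /kernel_chart.
by rewrite eS1 eB1 eT1 eS2 eB2 eT2 eS3 eB3 eT3 -EW -EZ -E1 -E2 -E3.
Qed.

Lemma stratum_hausdorff0 (s : R) : #|idx|%:R < s ->
  hausdorff s [set x | @chain_complexes R a0 a1 a2 a3 x /\
    [/\ \rank (mat_d1 x) = r1, \rank (mat_d2 x) = r2 & \rank (mat_d3 x) = r3]] = 0%E.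
Proof.
move=> ids; apply: sub_hausdorff0 stratum_sub_charts _.
apply: bigcup_countable_hausdorff0 => -[[[s1 t1] [s2 t2]] [s3 t3]].
apply: hausdorff_locLip_image0 ids => k; apply: locLip_cx_tuple.
- exact: locLip_chart.
- by apply: locLipmxM; [exact: locLip_kernel_chart|exact: locLip_chart].
- by apply: locLipmxM; [exact: locLip_kernel_chart|exact: locLip_chart].
Qed.

(* B, S, T are read off from d1 and from the lower parts of d2 and d3, which are
   free; the upper parts of d2, d3 and the lower right blocks are then
   determined through B^-1 T, except that of d3, which may be 0. *)
Lemma hausdorff0_chain_complexes (s : R) : 0 <= s ->
  hausdorff s (@chain_complexes R a0 a1 a2 a3) = 0%E -> #|idx|%:R <= s.
Proof.
pose F (k : idx) (x : (dimN a0 a1 a2 a3).-tuple R) : R :=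
  match k with
  | inl (inl k) =>
    block_param (dlsubmx (mat_d1 x)) (ulsubmx (mat_d1 x)) (ursubmx (mat_d1 x)) k
  | inl (inr k) => let d := dsubmx (mat_d2 x) in
    block_param (dlsubmx d) (ulsubmx d) (ursubmx d) k
  | inr k => let d := dsubmx (mat_d3 x) in
    block_param (dlsubmx d) (ulsubmx d) (ursubmx d) k
  end.
(* Small enough for [near_id_unitmx] on blocks of sizes [r1] and [r2]. Below, [ctr] is the lower
   corner of the cube of side [e + e], hence the shift by [- e]. *)
pose e : R := (r1 + r2).+1%:R^-1.
have e0 : 0 < e by rewrite invr_gt0.
pose ctr (k : idx) : R := match k with
  | inl (inl (inl (inr ij))) => (ij.1 == ij.2)%:R - e
  | inl (inr (inl (inr ij))) => (ij.1 == ij.2)%:R - e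
  | _ => 0 end.
apply: (@hausdorff0_ge_dim _ _ _ _ F ctr (e + e)); first by rewrite addr_gt0.
  move=> [[[[ij|ij]|ij]|[[ij|ij]|ij]]|[[ij|ij]|ij]] x y; rewrite /F/= !mxE; exact: nth_edist.
move=> p Hp.
have unitB (q : nat) (B : 'M[R]_q) : (q <= r1 + r2)%N ->
    (forall i j, (i == j)%:R - e <= B i j <= (i == j)%:R - e + (e + e)) -> B \in unitmx.
  move=> qr HB; apply: (@near_id_unitmx _ _ _ e) => [i j|].
    by rewrite ler_distl; have := HB i j; rewrite addrA subrK.
  by rewrite ltr_pdivrMr// mul1r ltr_nat ltnS.
have B1u : blockB (p \o idx1) \in unitmx.
  by apply: unitB => [|i j]; rewrite ?leq_addr// mxE; exact: (Hp (idx1 (inl (inr (i, j))))).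
have B2u : blockB (p \o idx2) \in unitmx.
  by apply: unitB => [|i j]; rewrite ?leq_addl// mxE; exact: (Hp (idx2 (inl (inr (i, j))))).
pose q1 := p \o idx1; pose q2 := p \o idx2; pose q3 := p \o idx3.
have [K1 BK1] : exists K, blockB q1 *m K = blockT q1.
  by exists (invmx (blockB q1) *m blockT q1); rewrite mulKVmx.
have [K2 BK2] : exists K, blockB q2 *m K = blockT q2.
  by exists (invmx (blockB q2) *m blockT q2); rewrite mulKVmx.
(* Since B K1 = T, both block rows of [d1] kill the column (-K1; 1), so any [W] can be completed on
   top by [- K1 *m W]; likewise for [W] and [Z]. *)
pose d1 : 'M[R]_(a0, a1) := block_mx (blockB q1) (blockT q1) (blockS q1) (blockS q1 *m K1).
pose W : 'M[R]_(r2 + c1, a2) :=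
  block_mx (blockB q2) (blockT q2) (blockS q2) (blockS q2 *m K2).
pose Z : 'M[R]_(r3 + c2, a3) := block_mx (blockB q3) (blockT q3) (blockS q3) 0.
pose d2 : 'M[R]_(a1, a2) := col_mx (- K1 *m W) W.
pose d3 : 'M[R]_(a2, a3) := col_mx (- K2 *m Z) Z.
have WZ : W *m d3 = 0.
  rewrite /W /d3 mul_block_col !mulmxA !mulmxN !mulNmx.
  by rewrite BK2 !addNr col_mx0.
exists (cx_tuple d1 d2 d3).
  rewrite /chain_complexes /= mat_d1_cx_tuple mat_d2_cx_tuple mat_d3_cx_tuple; split.
    rewrite /d1 /d2 mul_block_col !mulmxA !mulmxN !mulNmx.
    by rewrite BK1 !addNr col_mx0.
  by rewrite /d2 mul_col_mx -mulmxA WZ mulmx0 col_mx0.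
move=> [[k|k]|k]; rewrite /F ?mat_d1_cx_tuple ?mat_d2_cx_tuple ?mat_d3_cx_tuple.
- rewrite block_mxKdl block_mxKul block_mxKur.
  by case: k => [[[i j]|[i j]]|[i j]]; rewrite /= mxE.
- rewrite col_mxKd block_mxKdl block_mxKul block_mxKur.
  by case: k => [[[i j]|[i j]]|[i j]]; rewrite /= mxE.
- rewrite col_mxKd block_mxKdl block_mxKul block_mxKur.
  by case: k => [[[i j]|[i j]]|[i j]]; rewrite /= mxE.
Qed.

End Strata.

(** * Integration against an outer measure *)

Import HBNNSimple.

Section OuterIntegral.
Context {d} {T : measurableType d} {R : realType}.
Variable mu : {outer_measure set T -> \bar R}.
Local Open Scope ereal_scope.
Implicit Types (f : T -> R) (h : {nnsfun T >-> R}) (D G : set T).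

Lemma restrict_EFin_in f D x : D x -> ((EFin \o f) \_ D) x = (f x)%:E.
Proof. by move=> Dx; rewrite patchE mem_set. Qed.

Lemma restrict_EFin_notin f D x : ~ D x -> ((EFin \o f) \_ D) x = 0%:E.
Proof. by move=> Dx; rewrite patchE memNset. Qed.

Lemma restrict_EFin_ge0 f D x : (0 <= f x)%R -> 0%:E <= ((EFin \o f) \_ D) x.
Proof.
move=> f0; have [Dx|Dx] := pselect (D x).
  by rewrite restrict_EFin_in// lee_fin.
by rewrite restrict_EFin_notin.
Qed.

(* hausdorff is used in cx_mass as a raw set function, known here to be an
   outer measure only, so the integration lemmas on {measure _} do not apply. *)
Lemma sintegral_outer_eq0 h :
  (forall r, (0 < r)%R -> mu (h @^-1` [set r]) = 0) -> sintegral mu h = 0.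
Proof.
move=> h0; apply: fsbig1 => r _.
have [r0|r0|<-] := ltgtP 0%R r; last by rewrite mul0e.
  by rewrite h0// mule0.
rewrite preimage10 ?outer_measure0 ?mule0//= => -[t _ htr].
by move: r0; rewrite -htr ltNge fun_ge0.
Qed.

Lemma ge0_outer_integralE f D : (forall x, 0 <= f x)%R ->
  \int[mu]_(x in D) (f x)%:E =
  ereal_sup [set sintegral mu h | h in [set h : {nnsfun T >-> R} |
    forall x, (h x)%:E <= ((EFin \o f) \_ D) x]].
Proof.
move=> f0; rewrite /integral funeneg_restrict funepos_restrict.
have fp : ((EFin \o f) ^\+ = EFin \o f)%E.
  by apply/funext => x; rewrite funeposE max_l//= lee_fin.
have fn : ((EFin \o f) ^\- = cst 0)%E.
  by apply/funext => x; rewrite funenegE max_r//= lee_fin oppr_le0.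
rewrite fp fn erestrict0 [X in _ - X](_ : _ = 0) ?sube0//.
apply/eqP; rewrite eq_le; apply/andP; split.
  apply: ge_ereal_sup => _ [h /= h0 <-]; rewrite sintegral_outer_eq0// => r r0.
  rewrite preimage10 ?outer_measure0// => -[t _ htr].
  by have := h0 t; rewrite htr lee_fin leNgt r0.
apply: ereal_sup_ubound; exists nnsfun0 => //.
rewrite sintegral_outer_eq0// => r r0.
by rewrite preimage10 ?outer_measure0// => -[t _ /= t0]; rewrite -t0 ltxx in r0.
Qed.

(** A simple function below [f] restricted to [D] has its positive level sets inside [D]. *)
Lemma outer_integral_null f D : (forall x, 0 <= f x)%R -> mu D = 0 ->
  \int[mu]_(x in D) (f x)%:E = 0.
Proof.
move=> f0 D0; rewrite ge0_outer_integralE//.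
apply/eqP; rewrite eq_le; apply/andP; split.
  apply: ge_ereal_sup => _ [h /= hf <-]; rewrite sintegral_outer_eq0// => r r0.
  apply/eqP; rewrite eq_le outer_measure_ge0 andbT -D0.
  apply: le_outer_measure => t /= htr; apply: contrapT => Dt.
  by have := hf t; rewrite htr restrict_EFin_notin// lee_fin leNgt r0.
apply: ereal_sup_ubound; exists nnsfun0 => [x|].
  exact: restrict_EFin_ge0.
rewrite sintegral_outer_eq0// => r r0.
by rewrite preimage10 ?outer_measure0// => -[t _ /= t0]; rewrite -t0 ltxx in r0.
Qed.

Lemma subset_outer_integral f D G : (forall x, 0 <= f x)%R -> G `<=` D ->
  \int[mu]_(x in G) (f x)%:E <= \int[mu]_(x in D) (f x)%:E.
Proof.
move=> f0 GD; rewrite !ge0_outer_integralE//; apply: le_ereal_sup => _ [h /= hf <-].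
exists h => //= x; apply: le_trans (hf x) _.
have [Gx|Gx] := pselect (G x).
  by rewrite !restrict_EFin_in//; exact: GD.
by rewrite restrict_EFin_notin// restrict_EFin_ge0.
Qed.

(** A simple function on [D] is multiplied by the indicator of [G], which stays simple as [G] is
    measurable. Each positive level set loses only a part of the null set, so subadditivity keeps
    its outer measure. *)
Lemma outer_integral_setD_null f D G : (forall x, 0 <= f x)%R -> measurable G ->
  G `<=` D -> mu (D `\` G) = 0 ->
  \int[mu]_(x in G) (f x)%:E = \int[mu]_(x in D) (f x)%:E.
Proof.
move=> f0 mG GD DG0; apply/eqP; rewrite eq_le subset_outer_integral//=.
rewrite !ge0_outer_integralE//; apply: ge_ereal_sup => _ [h /= hf <-].
pose h' := proj_nnsfun h mG.
apply: (@le_trans _ _ (sintegral mu h')); last first.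
  apply: ereal_sup_ubound; exists h' => // x.
  suff : (h x * \1_G x)%:E <= ((EFin \o f) \_ G) x by [].
  rewrite indicE.
  have [Gx|Gx] := pselect (G x).
    by rewrite mem_set// mulr1 restrict_EFin_in// -(restrict_EFin_in _ _ _ (GD _ Gx)).
  by rewrite memNset// mulr0 restrict_EFin_notin.
rewrite /sintegral.
(* A common finite support, so that the two sums are compared term by term. *)
pose A := range h `|` range h'.
have finA : finite_set A by rewrite finite_setU.
have out (k : {nnsfun T >-> R}) : range k `<=` A -> forall r, (setT `\` A) r ->
    r%:E * mu (k @^-1` [set r]) = 0.
  move=> kA r [_ Ar]; rewrite preimage10 ?outer_measure0 ?mule0// => kr.
  exact/Ar/kA.
rewrite -(fsbig_widen A setT)//; last by apply: out => r; left.
rewrite -(fsbig_widen A setT)//; last by apply: out => r; right.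
apply: lee_fsum => // r Ar.
have [r0|r0|<-] := ltgtP 0%R r; last by rewrite !mul0e.
- apply: lee_wpmul2l; first by rewrite lee_fin ltW.
  rewrite -[leRHS]adde0 -DG0.
  apply: le_trans (le_outer_measure _ _ _ _) (outer_measureU2 _ _ _) => t /= htr.
  have [Gt|Gt] := pselect (G t); [left|right].
    suff : (h t * \1_G t)%R = r by [].
    by rewrite indicE mem_set// mulr1.
  split=> //; apply: contrapT => Dt.
  by have := hf t; rewrite htr restrict_EFin_notin// lee_fin leNgt r0.
- by case: Ar => -[t _ tr]; move: r0; rewrite -tr ltNge fun_ge0.
Qed.

End OuterIntegral.

(** * Measurability of rank conditions *)

Section MeasurableRank.
Context {d} {T : measurableType d} {R : realType}.

Lemma measurable_exists (I : finType) (P : I -> set T) :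
  (forall i, measurable (P i)) -> measurable [set x | exists i, P i x].
Proof.
move=> mP; rewrite (_ : [set _ | _] = \bigcup_(i in [set: I]) P i).
  by apply: fin_bigcup_measurable.
by apply/seteqP; split=> x /= [i]; exists i.
Qed.

Lemma measurable_forall (I : finType) (P : I -> set T) :
  (forall i, measurable (P i)) -> measurable [set x | forall i, P i x].
Proof.
move=> mP; rewrite (_ : [set _ | _] = \bigcap_(i in [set: I]) P i).
  by apply: fin_bigcap_measurable.
by apply/seteqP; split=> x /= Px i; [move=> _|]; exact: Px.
Qed.

Definition measurable_mx {m n : nat} (F : T -> 'M[R]_(m, n)) :=
  forall i j, measurable_fun setT (fun x => F x i j).

Lemma measurable_mx_mul {m n q : nat} (F : T -> 'M[R]_(m, n)) (G : T -> 'M[R]_(n, q)) :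
  measurable_mx F -> measurable_mx G -> measurable_mx (fun x => F x *m G x).
Proof.
move=> mF mG i j; under eq_fun do rewrite mxE.
by apply: measurable_sum => k; exact: measurable_funM.
Qed.

Lemma measurable_mx_eq0 {m n : nat} (F : T -> 'M[R]_(m, n)) :
  measurable_mx F -> measurable [set x | F x = 0].
Proof.
move=> mF; rewrite (_ : [set _ | _] = [set x | forall i, [set x | forall j, F x i j = 0] x]).
  apply: measurable_forall => i.
  apply: (@measurable_forall _ (fun j => [set x | F x i j = 0])) => j.
  rewrite -[X in measurable X]setTI; exact: (mF i j measurableT [set 0]).
apply/seteqP; split=> x /= F0; first by move=> i j; rewrite F0 mxE.
by apply/matrixP => i j; rewrite F0 mxE.
Qed.

Lemma measurable_det {n : nat} (F : T -> 'M[R]_n) :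
  measurable_mx F -> measurable_fun setT (fun x => \det (F x)).
Proof.
move=> mF; rewrite /determinant.
apply: measurable_sum => s; apply: measurable_funM => //.
by apply: measurable_prod => i _; exact: mF.
Qed.

Lemma measurable_rank_ge {m n : nat} (F : T -> 'M[R]_(m, n)) (k : nat) :
  measurable_mx F -> measurable [set x | (k <= \rank (F x))%N].
Proof.
(* Minors of every size from [k] on, since [rank_minor] yields one whose size is the rank itself. *)
move=> mF; pose minor_neq0 (r : 'I_m.+1)
    (fg : {ffun 'I_r -> 'I_m} * {ffun 'I_r -> 'I_n}) :=
  [set x | (k <= r)%N /\ \det (mxsub fg.1 fg.2 (F x)) != 0].
rewrite (_ : [set _ | _] = [set x | exists r, [set x | exists fg, minor_neq0 r fg x] x]).
  apply: measurable_exists => r; apply: measurable_exists => fg.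
  have [kr|kr] := leqP k r; last first.
    rewrite (_ : minor_neq0 r fg = set0)//; apply/seteqP; split=> x //= [].
    by rewrite leqNgt kr.
  rewrite (_ : minor_neq0 r fg = ~` [set x | \det (mxsub fg.1 fg.2 (F x)) = 0]).
    apply: measurableC; rewrite -[X in measurable X]setTI.
    apply: (measurable_det _ _ measurableT [set 0]) => // i j.
    by under eq_fun do rewrite mxE; exact: mF.
  by apply/seteqP; split=> x /= => [[_ /eqP]|/eqP].
apply/seteqP; split=> x /= => [kF|[r [fg [kr fg0]]]].
  have rm : (\rank (F x) < m.+1)%N by rewrite ltnS rank_leq_row.
  have [f [g fg]] := rank_minor _ _ _ (F x) erefl.
  by exists (Ordinal rm), (f, g).
exact: leq_trans kr (leq_rank_minor _ _ _ _ _ _ fg0).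
Qed.

Lemma measurable_rank_eq {m n : nat} (F : T -> 'M[R]_(m, n)) (k : nat) :
  measurable_mx F -> measurable [set x | \rank (F x) = k].
Proof.
move=> mF.
rewrite (_ : [set _ | _] =
  [set x | (k <= \rank (F x))%N] `\` [set x | (k.+1 <= \rank (F x))%N]).
  by apply: measurableD; exact: measurable_rank_ge.
apply/seteqP; split=> x /= => [->|[kF /negP]]; first by rewrite ltnn.
by rewrite -leqNgt => Fk; apply/eqP; rewrite eqn_leq Fk kF.
Qed.

End MeasurableRank.

Section MeasurableComplexes.
Context {R : realType} {a0 a1 a2 a3 : nat}.
Implicit Types x : (dimN a0 a1 a2 a3).-tuple R.

Lemma measurable_nth (N k : nat) : measurable_fun setT (fun x : N.-tuple R => nth 0 x k).
Proof.
have [kN|kN] := ltnP k N; last first.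
  by under eq_fun do rewrite nth_default ?size_tuple//; exact: measurable_cst.
have -> : k = Ordinal kN by []; under eq_fun do rewrite -tnth_nth.
exact: measurable_tnth.
Qed.

Lemma measurable_mat_d1 : measurable_mx (fun x => mat_d1 x).
Proof. by move=> i j; under eq_fun do rewrite mxE; exact: measurable_nth. Qed.

Lemma measurable_mat_d2 : measurable_mx (fun x => mat_d2 x).
Proof. by move=> i j; under eq_fun do rewrite mxE; exact: measurable_nth. Qed.

Lemma measurable_mat_d3 : measurable_mx (fun x => mat_d3 x).
Proof. by move=> i j; under eq_fun do rewrite mxE; exact: measurable_nth. Qed.

Lemma measurable_chain_complexes : measurable (@chain_complexes R a0 a1 a2 a3).
Proof.
apply: measurableI; apply: measurable_mx_eq0; apply: measurable_mx_mul.
- exact: measurable_mat_d1.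
- exact: measurable_mat_d2.
- exact: measurable_mat_d2.
- exact: measurable_mat_d3.
Qed.

Lemma measurable_betti_sum (v : int) :
  measurable [set x : (dimN a0 a1 a2 a3).-tuple R | betti_sum x = v].
Proof.
pose P (u : 'I_a0.+1 * 'I_a1.+1 * 'I_a2.+1) : set ((dimN a0 a1 a2 a3).-tuple R) :=
  [set x | betti_sum x = v] `&` ([set x | \rank (mat_d1 x) = u.1.1] `&`
   [set x | \rank (mat_d2 x) = u.1.2] `&` [set x | \rank (mat_d3 x) = u.2]).
rewrite (_ : [set _ | _] = [set x | exists u, P u x]).
  apply: measurable_exists => u; rewrite /P.
  set A := (X in _ `&` X).
  have mA : measurable A.
    apply: measurableI; first apply: measurableI.
    - by apply: measurable_rank_eq; exact: measurable_mat_d1.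
    - by apply: measurable_rank_eq; exact: measurable_mat_d2.
    - by apply: measurable_rank_eq; exact: measurable_mat_d3.
  (* The Betti sum depends on the ranks only, so it is constant on [A]: the intersection is [A] or
     empty. *)
  have [[x0 [Ax0 bx0]]|nA] := pselect (exists x, A x /\ betti_sum x = v).
    rewrite (_ : _ `&` A = A)//; apply/seteqP; split=> x; first by case.
    move=> Ax; split=> //=; rewrite -bx0.
    move: Ax Ax0 => [[/= e1 e2] e3] [[/= f1 f2] f3].
    by rewrite /betti_sum e1 e2 e3 f1 f2 f3.
  rewrite (_ : _ `&` A = set0)//; apply/seteqP; split=> x //= -[xv Ax].
  by apply: nA; exists x.
apply/seteqP; split=> x /= => [xv|[u []//]].
have r1 : (\rank (mat_d1 x) < a0.+1)%N by rewrite ltnS rank_leq_row.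
have r2 : (\rank (mat_d2 x) < a1.+1)%N by rewrite ltnS rank_leq_row.
have r3 : (\rank (mat_d3 x) < a2.+1)%N by rewrite ltnS rank_leq_row.
by exists (Ordinal r1, Ordinal r2, Ordinal r3).
Qed.

End MeasurableComplexes.

(** * Comparing strata *)

Lemma card_cx_idx r1 c0 r2 c1 r3 c2 c3 : #|cx_idx r1 c0 r2 c1 r3 c2 c3| =
  (c0 * r1 + r1 * r1 + r1 * (r2 + c1) + (c1 * r2 + r2 * r2 + r2 * (r3 + c2)) +
   (c2 * r3 + r3 * r3 + r3 * c3))%N.
Proof. by rewrite /cx_idx !card_sum !card_prod !card_ord. Qed.

(* If two consecutive c_i, c_(i+1) are positive, increase the rank between them;
   otherwise c1 = c2 = 0 < c0, c3, the inequalities force r2 > 0, and the ranks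
   (r1 + 1, r2 - 1, r3 + 1) are better. *)
Lemma improve_ranks (a0 a1 a2 a3 r1 c0 r2 c1 r3 c2 c3 : nat) :
  (a0 <= a1)%N -> (a3 <= a2)%N ->
  a0 = (r1 + c0)%N -> a1 = (r1 + (r2 + c1))%N -> a2 = (r2 + (r3 + c2))%N ->
  a3 = (r3 + c3)%N -> (0 < c0 + c2)%N -> (0 < c1 + c3)%N ->
  exists r1' c0' r2' c1' r3' c2' c3', [/\ a0 = (r1' + c0')%N,
    a1 = (r1' + (r2' + c1'))%N, a2 = (r2' + (r3' + c2'))%N, a3 = (r3' + c3')%N &
    (#|cx_idx r1 c0 r2 c1 r3 c2 c3| < #|cx_idx r1' c0' r2' c1' r3' c2' c3'|)%N].
Proof.
move=> h0 h3 e0 e1 e2 e3 even odd.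
have [b01|b01] := boolP ((0 < c0)%N && (0 < c1)%N).
  (* The dimension grows by [c0 + c1 - 1]; in the next two cases by [c1 + c2 - 1] and
     [c2 + c3 - 1]. *)
  exists r1.+1, c0.-1, r2, c1.-1, r3, c2, c3; rewrite !card_cx_idx.
  by case: c0 c1 => [|c0] [|c1] in e0 e1 even odd b01 *; split => //=; lia.
have [b12|b12] := boolP ((0 < c1)%N && (0 < c2)%N).
  exists r1, c0, r2.+1, c1.-1, r3, c2.-1, c3; rewrite !card_cx_idx.
  by case: c1 c2 => [|c1] [|c2] in e1 e2 even odd b01 b12 *; split => //=; lia.
have [b23|b23] := boolP ((0 < c2)%N && (0 < c3)%N).
  exists r1, c0, r2, c1, r3.+1, c2.-1, c3.-1; rewrite !card_cx_idx.
  by case: c2 c3 => [|c2] [|c3] in e2 e3 even odd b12 b23 *; split => //=; lia.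
(* Now [a0 <= a1] reads [c0 <= r2], so [r2] can be lowered; the gain is [c0 + c3 - 1]. *)
exists r1.+1, c0.-1, r2.-1, c1, r3.+1, c2, c3.-1; rewrite !card_cx_idx.
have [c10 c20] : c1 = 0%N /\ c2 = 0%N by lia.
subst c1 c2.
by case: c0 r2 c3 => [|c0] [|r2] [|c3] in h0 h3 e0 e1 e2 e3 even odd b01 b12 b23 *;
  split => //=; lia.
Qed.

Section ModelDimension.
Context {R : realType} {a0 a1 a2 a3 r1 c0 r2 c1 r3 c2 c3 : nat}.
Hypotheses (e0 : a0 = (r1 + c0)%N) (e1 : a1 = (r1 + (r2 + c1))%N)
  (e2 : a2 = (r2 + (r3 + c2))%N) (e3 : a3 = (r3 + c3)%N).

Lemma rank_stratum_hausdorff0 (s : R) : #|cx_idx r1 c0 r2 c1 r3 c2 c3|%:R < s ->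
  hausdorff s [set x | @chain_complexes R a0 a1 a2 a3 x /\
    [/\ \rank (mat_d1 x) = r1, \rank (mat_d2 x) = r2 & \rank (mat_d3 x) = r3]] = 0%E.
Proof. by move: e0 e1 e2 e3 => -> -> -> ->; exact: stratum_hausdorff0. Qed.

Lemma le_model_dim : #|cx_idx r1 c0 r2 c1 r3 c2 c3|%:R <= model_dim a0 a1 a2 a3 :> R.
Proof.
pose N := dimN a0 a1 a2 a3.
(* An exponent for which the variety is null makes the infimum finite, so that [fine] returns the
   actual dimension. *)
have MN : hausdorff (N.+1%:R : R) (@chain_complexes R a0 a1 a2 a3) = 0%E.
  pose Phi (p : 'I_N -> R) := [tuple p i | i < N].
  apply: (sub_hausdorff0 _ _ (range Phi)).
    by move=> x _; exists (tnth x) => //; apply: eq_from_tnth => i; rewrite tnth_mktuple.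
  apply: hausdorff_locLip_image0; last by rewrite card_ord ltr_nat.
  by move=> k; under eq_fun do rewrite tnth_mktuple; exact: locLip_coord.
rewrite /model_dim -lee_fin fineK.
  apply: le_ereal_inf_tmp => _ [s [s0 Hs] <-]; rewrite lee_fin.
  by move: s0 Hs; move: e0 e1 e2 e3 => -> -> -> ->; exact: hausdorff0_chain_complexes.
rewrite ge0_fin_numE.
  rewrite (@le_lt_trans _ _ N.+1%:R%:E) ?ltry//.
  by apply: ereal_inf_lbound; exists N.+1%:R.
by apply: le_ereal_inf_tmp => _ [s [s0 _] <-]; rewrite lee_fin.
Qed.

End ModelDimension.

Lemma bad_complexes_hausdorff0 {R : realType} (a0 a1 a2 a3 : nat) :
  (a0 <= a1)%N -> (a3 <= a2)%N ->
  hausdorff (model_dim a0 a1 a2 a3 : R) [set x | chain_complexes a0 a1 a2 a3 x /\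
    betti_sum x <> `|euler_char a0 a1 a2 a3|%R] = 0%E.
Proof.
move=> h0 h3; set Bad := [set _ | _].
pose stratum (w : nat * nat * nat) := Bad `&`
  [set x | \rank (mat_d1 x) = w.1.1 /\ \rank (mat_d2 x) = w.1.2 /\ \rank (mat_d3 x) = w.2].
apply: (sub_hausdorff0 _ _ (\bigcup_w stratum w)).
  by move=> x Bx; exists (\rank (mat_d1 x), \rank (mat_d2 x), \rank (mat_d3 x)).
apply: bigcup_countable_hausdorff0 => -[[r1 r2] r3].
have [[x [[[d12 d23] bx] [/= k1 [k2 k3]]]]|/nonemptyPn ->] :=
  pselect (stratum (r1, r2, r3) !=set0); last exact: hausdorff0.
(* These bounds make the Betti numbers nonnegative and the natural subtractions below exact. *)
have r1a := rank_leq_row (mat_d1 x); have r3a := rank_leq_col (mat_d3 x).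
have r12 := mulmx0_rank_max d12; have r23 := mulmx0_rank_max d23.
move: bx; rewrite /betti_sum /euler_char k1 k2 k3 => bx.
rewrite k1 in r1a r12; rewrite k2 in r12 r23; rewrite k3 in r23 r3a.
have e0 : a0 = (r1 + (a0 - r1))%N by lia.
have e1 : a1 = (r1 + (r2 + (a1 - r1 - r2)))%N by lia.
have e2 : a2 = (r2 + (r3 + (a2 - r2 - r3)))%N by lia.
have e3 : a3 = (r3 + (a3 - r3))%N by lia.
(* The Euler characteristic is the even Betti sum minus the odd one; if either vanished, its
   absolute value would be the total. *)
have even : (0 < (a0 - r1) + (a2 - r2 - r3))%N by apply: contra_notT bx; lia.
have odd : (0 < (a1 - r1 - r2) + (a3 - r3))%N by apply: contra_notT bx; lia.
have [s1 [b0 [s2 [b1 [s3 [b2 [b3 [f0 f1 f2 f3 lt_dim]]]]]]]] :=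
  improve_ranks _ _ _ _ _ _ _ _ _ _ _ h0 h3 e0 e1 e2 e3 even odd.
have dimk := lt_le_trans _ (@le_model_dim R _ _ _ _ _ _ _ _ _ _ _ f0 f1 f2 f3).
apply: sub_hausdorff0 (rank_stratum_hausdorff0 e0 e1 e2 e3 _ (dimk _ _)).
  by move=> y [[My _] /= [? [? ?]]].
by rewrite ltr_nat.
Qed.

Theorem theorem3p3 (R : realType) (a0 a1 a2 a3 : nat)
  (h0 : (a0 <= a1)%N) (h1 : (a1 <= a0 + a2)%N)
  (h2 : (a2 <= a1 + a3)%N) (h3 : (a3 <= a2)%N)
  (f : (dimN a0 a1 a2 a3).-tuple R -> R)
  (hf : bounded_density f)
  (hpos : (0 < cx_mass f (chain_complexes a0 a1 a2 a3))%E) :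
  let Good := [set x | chain_complexes a0 a1 a2 a3 x /\
                       betti_sum x = `|euler_char a0 a1 a2 a3|%R] in
  (cx_mass f (chain_complexes a0 a1 a2 a3 `\` Good) = 0)%E /\
  ((cx_mass f (chain_complexes a0 a1 a2 a3) < +oo)%E ->
     cx_prob f Good = 1%E).
Proof.
move=> Good; have [_ f0 _ _] := hf.
have bad0 : hausdorff (model_dim a0 a1 a2 a3) (chain_complexes a0 a1 a2 a3 `\` Good) = 0%E.
  apply: sub_hausdorff0 (@bad_complexes_hausdorff0 R _ _ _ _ h0 h3).
  by move=> x [Mx Gx]; split=> // bx; apply: Gx.
split; first exact: outer_integral_null.
move=> moo; rewrite /cx_prob.
have -> : cx_mass f Good = cx_mass f (chain_complexes a0 a1 a2 a3).
  apply: outer_integral_setD_null => //; last by move=> x [].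
  apply: measurableI; first exact: measurable_chain_complexes.
  exact: measurable_betti_sum.
by rewrite divee ?gt_eqF// fin_real// (lt_trans _ hpos).
Qed.
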